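(* Let $a\in\mathbb{Z}$ with $3\nmid a$, and let $f_a(x) = -8ax^3-(8a+2)x^2+(4a-1)x+a$. Then $f_a$ is irreducible (over $\mathbb{Q}$) and has emergent reducibility at depth $1$; that is, $f_a$ is irreducible over $\mathbb{Q}$ while $f_a\circ f_a$ is reducible over $\mathbb{Q}$.
   Context: For a field $K$ and $f\in K[x]$, write $f^{\circ 0}=f$ and $f^{\circ k}=f\circ f^{\circ (k-1)}$. The polynomial $f$ has emergent reducibility at depth $n$ over $K$ if $f^{\circ i}$ is irreducible over $K$ for $0\le i\le n-1$ and $f^{\circ n}$ is reducible over $K$. Here $K=\mathbb{Q}$. *)

(* Defs.v *)
From HB Require Import structures.
From mathcomp Require Import all_boot all_order all_algebra.

Set Implicit Arguments.
Unset Strict Implicit.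
Unset Printing Implicit Defensive.

Import Order.TTheory GRing.Theory Num.Theory.
Local Open Scope ring_scope.

(* The indexing starts at f itself, not at 'X: iter_poly f 0 = f and
   iter_poly f 1 = f \Po f, so iter_poly f k is the (k+1)-fold composite. *)
Fixpoint iter_poly (K : fieldType) (f : {poly K}) (k : nat) : {poly K} :=
  if k is k'.+1 then f \Po iter_poly f k' else f.

Definition reducible_poly (K : fieldType) (p : {poly K}) : Prop :=
  exists g h : {poly K}, [/\ (1 < size g)%N, (1 < size h)%N & p = g * h].

Definition emergent_reducibility (K : fieldType) (f : {poly K}) (n : nat) : Prop :=
  (forall i : nat, (i < n)%N -> irreducible_poly (iter_poly f i)) /\
  reducible_poly (iter_poly f n).

Definition f_ (a : int) : {poly rat} :=
  (- 8 * a)%:~R *: 'X^3 - (8 * a + 2)%:~R *: 'X^2 + (4 * a - 1)%:~R *: 'X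
  + a%:~R%:P.

(* Main.v *)
Require Import Defs.
From HB Require Import structures.
From mathcomp Require Import all_boot all_order all_algebra.
From mathcomp Require Import ring zify.

Import Order.TTheory GRing.Theory Num.Theory.
Local Open Scope ring_scope.

(** A rational root [p / q] of [f_ a] in lowest terms gives a zero [(p, q)] of
    the homogenised cubic.  Modulo 3, for [a = 1] and for [a = 2], that binary
    form has no zero but [(0, 0)], so 3 would divide both [p] and [q].
    Hence the cubic [f_ a] has no rational root and is irreducible.  The
    reducibility of [f_ a \Po f_ a] is witnessed by an explicit factorisation
    into a cubic and a sextic, valid identically in [a]. *)

(* The two factors were found by grouping, for small [a], one preimage under
   [f_ a] of each root of [f_ a] so that the symmetric functions are rational,
   and interpolating in [a]. *)
Definition iterate_cubic_factor (a : int) : {poly rat} :=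
  (32 * a ^+ 2)%:~R *: 'X^3 + (32 * a ^+ 2 + 16 * a)%:~R *: 'X^2
  + (- 16 * a ^+ 2 + 12 * a + 2)%:~R *: 'X + (- 4 * a ^+ 2 - 4 * a + 1)%:~R%:P.

Definition iterate_sextic_factor (a : int) : {poly rat} :=
  (128 * a ^+ 2)%:~R *: 'X^6 + (256 * a ^+ 2 + 32 * a)%:~R *: 'X^5
  + (32 * a)%:~R *: 'X^4 - (160 * a ^+ 2 + 16 * a + 4)%:~R *: 'X^3
  - (4 * a + 2)%:~R *: 'X^2 + (16 * a ^+ 2 + 1)%:~R *: 'X + (2 * a ^+ 2)%:~R%:P.

Lemma comp_f_factor (a : int) :
  f_ a \Po f_ a = iterate_cubic_factor a * iterate_sextic_factor a.
Proof.
rewrite {1}/f_ !(comp_polyB, comp_polyD, comp_polyZ, comp_polyC, comp_polyX).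
rewrite !comp_Xn_poly /f_ /iterate_cubic_factor /iterate_sextic_factor.
rewrite -!mul_polyC !rmorph_int; ring.
Qed.

Lemma coef_f3 (a : int) : (f_ a)`_3 = (- 8 * a)%:~R.
Proof. by rewrite /f_ !coefE /= ?(mulr0, mulr1, addr0, subr0). Qed.

Lemma size_f (a : int) : a != 0 -> size (f_ a) = 4.
Proof.
move=> a0; apply/eqP; rewrite eqn_leq; apply/andP; split.
  apply/leq_sizeP => -[|[|[|[|j]]]] // _.
  by rewrite /f_ !coefE /= ?(mulr0, addr0, subr0).
rewrite ltnNge; apply/negP => /leq_sizeP /(_ 3 isT).
by rewrite coef_f3 => /eqP; rewrite intr_eq0; lia.
Qed.

Lemma mod3_form_anisotropic (a p q : int) : ~~ (3 %| a)%Z ->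
  - 8 * a * p ^+ 3 - (8 * a + 2) * p ^+ 2 * q + (4 * a - 1) * p * q ^+ 2
    + a * q ^+ 3 = 0 ->
  (3 %| p)%Z && (3 %| q)%Z.
Proof.
rewrite !(dvdz_pcharf (pchar_Fp (isT : prime 3))) => a0.
move/(congr1 (fun z : int => z%:~R : 'F_3)).
rewrite !(rmorphD, rmorphB, rmorphM, rmorphXn, rmorphN) /=.
move: a%:~R p%:~R q%:~R a0 => A P Q.
(* With [A] nonzero, 18 triples remain, each settled by computation. *)
by case: A => -[|[|[|//]]] ? //; case: P => -[|[|[|//]]] ?;
  case: Q => -[|[|[|//]]] ?.
Qed.

Lemma root_f_num_den (a : int) (x : rat) : root (f_ a) x ->
  - 8 * a * numq x ^+ 3 - (8 * a + 2) * numq x ^+ 2 * denq x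
    + (4 * a - 1) * numq x * denq x ^+ 2 + a * denq x ^+ 3 = 0.
Proof.
move=> /rootP.
rewrite /f_ !(hornerD, hornerN, hornerZ, hornerXn, hornerX) hornerC.
move=> fx0; apply/eqP; rewrite -(intr_eq0 rat); apply/eqP.
(* Clear denominators by the cube of [denq x]; [numqE] gives [numq x] as [x] times [denq x]. *)
rewrite -[RHS](mul0r ((denq x)%:~R ^+ 3)) -fx0.
by ring: (numqE x).
Qed.

Lemma f_no_root (a : int) (x : rat) : ~~ (3 %| a)%Z -> ~~ root (f_ a) x.
Proof.
move=> ha; apply/negP => /root_f_num_den /mod3_form_anisotropic -/(_ ha).
rewrite !dvdzE /= => /andP[dp dq].
by have := dvdn_gcd 3 `|numq x| `|denq x|; rewrite (eqP (coprime_num_den x)) dp dq.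
Qed.

Lemma irreducible_f (a : int) : ~~ (3 %| a)%Z -> irreducible_poly (f_ a).
Proof.
move=> ha; apply: cubic_irreducible => [|x]; last exact: f_no_root.
by rewrite size_f //; apply: contraNneq ha => ->; rewrite dvdz0.
Qed.

Lemma reducible_comp_f (a : int) : a != 0 -> reducible_poly (f_ a \Po f_ a).
Proof.
move=> a0; exists (iterate_cubic_factor a), (iterate_sextic_factor a).
(* A constant factor would make its leading coefficient, [32 * a ^+ 2] or [128 * a ^+ 2], vanish. *)
split; last exact: comp_f_factor; rewrite ltnNge; apply/negP => /leq_sizeP.
  move=> /(_ 3 isT); rewrite /iterate_cubic_factor !coefE /=.
  rewrite ?(mulr0, mulr1, addr0, subr0) => /eqP; rewrite intr_eq0; nia.
move=> /(_ 6 isT); rewrite /iterate_sextic_factor !coefE /=.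
  rewrite ?(mulr0, mulr1, addr0, subr0) => /eqP; rewrite intr_eq0; nia.
Qed.

Theorem theorem3p1 (a : int) (ha : ~~ (3 %| a)%Z) :
  irreducible_poly (f_ a) /\ emergent_reducibility (f_ a) 1.
Proof.
split; first exact: irreducible_f.
(* Below 1 only index 0 occurs, where [iter_poly] is [f_ a] itself. *)
split=> [[|i] //|]; first by move=> _; exact: irreducible_f.
by apply: reducible_comp_f; apply: contraNneq ha => ->; rewrite dvdz0.
Qed.
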